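(* Let $N\ge1$ and $d\ge2$. (a) Any SSW for a tree network in $\mathcal{G}_N$ (a graph in $\mathcal{G}_N$ that is a tree) is also an SSW for any other network $G\in\mathcal{G}_N$. (b) The sets of SSWs for all tree networks in $\mathcal{G}_N$ coincide.
   Context: $\mathcal{G}_N$ is the set of finite connected simple undirected graphs whose edges are labelled $1,\dots,N$ (vertex sets may differ). To each label $i$ is attached $\mathcal{H}_i=\mathbb{C}^d\otimes\mathbb{C}^d$, with $\mathbb{I}_i$ its identity and $\Phi_i=|\phi^+\rangle\langle\phi^+|$, $|\phi^+\rangle=\frac1{\sqrt d}\sum_{k=0}^{d-1}|kk\rangle$. Given $G=(V,E)\in\mathcal{G}_N$, vertices are parties, and the two tensor factors of $\mathcal{H}_i$ are held by the two endpoints of edge $i$ in $G$ (which endpoint holds which factor is immaterial below, since the partial transposes of $\Phi_i$ on either factor coincide). For $S\subseteq V$ with $S\neq\emptyset,V$ (nontrivial), $\Gamma_S$ is the partial transpose (computational basis) on all factors held by parties in $S$. A Hermitian operator $W$ on $\bigotimes_{i=1}^N\mathcal{H}_i$ is fully decomposable for $G$ if for every nontrivial $S\subseteq V$ there exist positive semidefinite $P_S,Q_S$ with $W=P_S+Q_S^{\Gamma_S}$. A sub-symmetric witness (SSW) for $G$ is an operator $W=\sum_{T\subseteq\{1,\dots,N\}}w_T\bigotimes_{i\in T}\Phi_i\otimes\bigotimes_{i\notin T}(\mathbb{I}_i-\Phi_i)$, $w_T\in\mathbb{R}$, that is fully decomposable for $G$. *)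

(* Defs.v *)
From HB Require Import structures.
From mathcomp Require Import all_boot all_order all_algebra.
From mathcomp Require Import sesquilinear spectral.
From mathcomp Require Import reals complex.

Set Implicit Arguments.
Unset Strict Implicit.
Unset Printing Implicit Defensive.

Import Order.TTheory GRing.Theory Num.Theory.

Local Open Scope ring_scope.
Local Open Scope complex_scope.
Local Open Scope sesquilinear_scope.

Definition edge_adj (N : nat) (V : finType) (e1 e2 : 'I_N -> V) : rel V :=
  fun u v => [exists i, [set e1 i; e2 i] == [set u; v]].

(* A finite connected simple graph whose edges are labelled by 'I_N.  The
   order of the two endpoints of edge i carries no graph-theoretic content: it
   only records which endpoint holds which tensor factor of H_i.  Injectivity
   is required of the unordered pairs, so there are no parallel edges. *)
Record network (N : nat) := Network {
  vertex : finType;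
  end1 : 'I_N -> vertex;
  end2 : 'I_N -> vertex;
  noloop : forall i, end1 i != end2 i;
  simple_edges : injective (fun i => [set end1 i; end2 i]);
  connected : forall x y : vertex, connect (edge_adj end1 end2) x y
}.

Definition adj (N : nat) (G : network N) : rel (vertex G) :=
  edge_adj (@end1 N G) (@end2 N G).

(* Connectedness is part of [network]. *)
Definition is_tree (N : nat) (G : network N) : Prop :=
  forall p : seq (vertex G), (2 < size p)%N -> ~ ucycle (@adj N G) p.

(* Operators on the complex Hilbert space with orthonormal basis B; the complex
   field is R[i] with R : realType. *)
Notation operator R B := 'M[R[i]]_#|{: B}|.

Definition op_of (R : realType) (B : finType) (F : B -> B -> R[i]) :
    operator R B :=
  \matrix_(a, b) F (enum_val a) (enum_val b).

Definition entry (R : realType) (B : finType) (A : operator R B) (x y : B) :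
    R[i] :=
  A (enum_rank x) (enum_rank y).

(* Labels of the computational bases of C^d (x) C^d and of the tensor product
   of the H_i. *)
Notation pair_basis d := ('I_d * 'I_d)%type.
Notation net_basis N d := {ffun 'I_N -> pair_basis d}.

(* In the canonical order of R[i], 0 <= z forces z to be real; hence psd
   operators are Hermitian. *)
Definition psd (R : realType) (n : nat) (A : 'M[R[i]]_n) : Prop :=
  forall v : 'cV[R[i]]_n, 0 <= (v ^t* *m A *m v) 0 0.

Definition tensor (R : realType) (N : nat) (B : finType)
    (A : 'I_N -> operator R B) : operator R {ffun 'I_N -> B} :=
  op_of (fun x y : {ffun 'I_N -> B} => \prod_(i < N) entry (A i) (x i) (y i)).

Definition ket (R : realType) (B : finType) (x : B) : 'cV[R[i]]_#|B| :=
  delta_mx (enum_rank x) 0.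

Definition phi_plus (R : realType) (d : nat) : 'cV[R[i]]_#|{: pair_basis d}| :=
  (sqrtC d%:R)^-1 *: \sum_(k < d) ket R (k, k).

Definition Phi (R : realType) (d : nat) : operator R (pair_basis d) :=
  phi_plus R d *m (phi_plus R d) ^t*.

(* x with the tensor factors held by the parties in S taken from y *)
Definition mix (N d : nat) (G : network N) (S : {set vertex G})
    (x y : net_basis N d) : net_basis N d :=
  [ffun i => (if end1 G i \in S then (y i).1 else (x i).1,
              if end2 G i \in S then (y i).2 else (x i).2)].

Definition ptranspose (R : realType) (N d : nat) (G : network N)
    (S : {set vertex G}) (A : operator R (net_basis N d)) :
    operator R (net_basis N d) :=
  op_of (fun x y : net_basis N d => entry A (mix S x y) (mix S y x)).

Definition fully_decomposable (R : realType) (N d : nat) (G : network N)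
    (W : operator R (net_basis N d)) : Prop :=
  W \is hermsymmx /\
  forall S : {set vertex G}, S != set0 -> S != setT ->
    exists P Q : operator R (net_basis N d),
      [/\ psd P, psd Q & W = P + ptranspose S Q].

Definition sub_symmetric (R : realType) (N d : nat) (w : {set 'I_N} -> R) :
    operator R (net_basis N d) :=
  \sum_(T : {set 'I_N})
    (w T)%:C *: tensor (fun i => if i \in T then Phi R d else 1%:M - Phi R d).

Definition SSW (R : realType) (N d : nat) (G : network N)
    (W : operator R (net_basis N d)) : Prop :=
  (exists w : {set 'I_N} -> R, W = sub_symmetric d w) /\
  fully_decomposable G W.

(* Main.v *)
(** In a tree, removing an edge disconnects its endpoints, so every set of edges
    is the set of edges cut by some set of vertices. Given a nontrivial [S] in
    [G], whose set of cut edges is nonempty by connectedness, some nontrivial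
    [S'] in the tree thus cuts the same edges, and [W = P + Q^Gamma_S'].
    The transposes for [S] and [S'] differ by full transposes on single edges,
    which need not preserve positivity. So first apply to [W = P + Q^Gamma_S']
    the conditional expectation onto the span of the tensor products of [Phi]
    and [1 - Phi]. It fixes [W] and preserves positivity, and moving it through
    the partial transpose yields a positive map on [Q], namely the expectation
    onto the tensor products of the symmetric and antisymmetric projectors (on
    cut edges) or of [Phi] and [1 - Phi] (on the others). All these operators
    are invariant under transposition of single edges, so that [Gamma_S] and
    [Gamma_S'] agree on their span. *)

Require Import Defs.
From mathcomp Require Import all_boot all_order all_algebra.
From mathcomp Require Import sesquilinear spectral.
From mathcomp Require Import reals complex.
From mathcomp Require Import ring.

Set Implicit Arguments.
Unset Strict Implicit.
Unset Printing Implicit Defensive.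

Import Order.TTheory GRing.Theory Num.Theory.

Local Open Scope ring_scope.
Local Open Scope complex_scope.
Local Open Scope sesquilinear_scope.

(** * Cuts of networks and of trees *)

(** On these edges the transposition for [S] acts on exactly one of the two factors. *)
Definition cuts (N : nat) (G : network N) (S : {set vertex G}) (i : 'I_N) :=
  (end1 G i \in S) (+) (end2 G i \in S).

Lemma set2_addb (V : finType) (S : {set V}) (a b u v : V) :
  [set a; b] = [set u; v] ->
  (a \in S) (+) (b \in S) = (u \in S) (+) (v \in S).
Proof.
move=> E.
have : a \in [set u; v] by rewrite -E set21.
have : b \in [set u; v] by rewrite -E set22.
have : u \in [set a; b] by rewrite E set21.
have : v \in [set a; b] by rewrite E set22.
rewrite !inE.
do 4![case/orP=> /eqP ?]; subst=> //; exact: addbC.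
Qed.

Lemma cuts_set0 (N : nat) (G : network N) (i : 'I_N) :
  cuts (set0 : {set vertex G}) i = false.
Proof. by rewrite /cuts !inE. Qed.

Lemma cuts_setT (N : nat) (G : network N) (i : 'I_N) :
  cuts (setT : {set vertex G}) i = false.
Proof. by rewrite /cuts !inE. Qed.

(** If no edge were cut, [S] would be closed under adjacency, so by connectedness it would be
    everything. *)
Lemma nontrivial_cuts (N : nat) (G : network N) (S : {set vertex G}) :
  S != set0 -> S != setT -> exists i, cuts S i.
Proof.
case/set0Pn=> x xS SnT; apply/existsP; apply: contraR SnT => noc.
have clS : closed (@adj N G) S.
  move=> u v /existsP[i /eqP /(set2_addb S) E].
  have := existsPn noc i; rewrite /cuts E.
  by case: (u \in S) (v \in S) => [] [].
apply/eqP/setP=> y; rewrite inE -(closed_connect clS (connected x y)).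
exact: xS.
Qed.

Definition adj_except (N : nat) (G : network N) (i : 'I_N) : rel (vertex G) :=
  fun u v => [exists j, (j != i) && ([set end1 G j; end2 G j] == [set u; v])].

(** The component of one end of edge [i] after deletion of [i]; in a tree it defines the fundamental
    cut of [i]. *)
Definition side (N : nat) (G : network N) (i : 'I_N) : {set vertex G} :=
  [set v | connect (@adj_except N G i) (end1 G i) v].

(** A simple path joining the ends of [i] without using [i] would close up with [i] to a cycle. *)
Lemma tree_end2_notin_side (N : nat) (T : network N) (i : 'I_N) :
  is_tree T -> end2 T i \notin side T i.
Proof.
move=> acyc; rewrite inE; apply/negP=> /connectP[p0 path_p0 last_p0].
move: last_p0; case: (shortenP path_p0) => p path_p uniq_p _ last_p.
have adj_p : path (@adj N T) (end1 T i) p.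
  apply: sub_path path_p => u v /existsP[j /andP[_ E]].
  by apply/existsP; exists j.
apply: (acyc (end1 T i :: p)); last first.
  rewrite /ucycle uniq_p andbT /= rcons_path adj_p -last_p /=.
  by apply/existsP; exists i; rewrite setUC.
(* The cycle has more than two vertices: otherwise [i] would be a loop or have a parallel edge. *)
case: p path_p last_p {uniq_p adj_p} => [|v [|w p]] //=.
  by move=> _ E; have := noloop T i; rewrite E eqxx.
rewrite andbT => /existsP[j /andP[ji /eqP E]] last_p.
by case/eqP: ji; apply: (@simple_edges N T); rewrite /= E last_p.
Qed.

Lemma cuts_side (N : nat) (T : network N) (i j : 'I_N) :
  is_tree T -> cuts (side T i) j = (j == i).
Proof.
move=> acyc; rewrite /cuts; have [->|ji] := eqVneq j i.
  by rewrite (negbTE (tree_end2_notin_side i acyc)) inE connect0.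
have adj12 : adj_except i (end1 T j) (end2 T j).
  by apply/existsP; exists j; rewrite ji eqxx.
have adj21 : adj_except i (end2 T j) (end1 T j).
  by apply/existsP; exists j; rewrite ji setUC eqxx.
suff -> : (end1 T j \in side T i) = (end2 T j \in side T i) by rewrite addbb.
rewrite !inE; apply/idP/idP=> h; apply: connect_trans h _; exact: connect1.
Qed.

(* The symmetric difference of the sides of the edges in [C] cuts exactly [C]. *)
Lemma tree_cuts_all (N : nat) (T : network N) (C : pred 'I_N) :
  is_tree T -> exists S : {set vertex T}, forall j, cuts S j = C j.
Proof.
move=> acyc.
exists [set v | \big[addb/false]_(i | C i) (v \in side T i)] => j.
rewrite /cuts !inE -big_split /=.
rewrite (eq_bigr (fun i => i == j)) => [|i _]; last first.
  by rewrite eq_sym -(cuts_side i j acyc).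
have [Cj|nCj] := boolP (C j).
  rewrite (bigD1 j) //= eqxx big1 // => i /andP[_ /negbTE //].
rewrite big1 // => i Ci; apply: contraNF nCj => /eqP <-; exact: Ci.
Qed.

(** * Operators through their entries *)

Lemma sum_enum_rank (V : nmodType) (B : finType) (F : 'I_#|{: B}| -> V) :
  \sum_j F j = \sum_(x : B) F (enum_rank x).
Proof.
by rewrite (reindex enum_rank) //; apply: onW_bij; exact: enum_rank_bij.
Qed.

Section Entries.
Variables (R : realType) (B : finType).
Implicit Types (A C : operator R B) (x y : B).

Lemma entry_op_of (F : B -> B -> R[i]) x y : entry (op_of F) x y = F x y.
Proof. by rewrite /entry mxE !enum_rankK. Qed.

Lemma entryP A C : (forall x y, entry A x y = entry C x y) -> A = C.
Proof.
move=> E; apply/matrixP=> a b.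
by have := E (enum_val a) (enum_val b); rewrite /entry !enum_valK.
Qed.

Lemma entry_mulmx A C x y :
  entry (A *m C) x y = \sum_z entry A x z * entry C z y.
Proof. by rewrite /entry mxE sum_enum_rank. Qed.

Lemma entry1 x y : entry (1%:M : operator R B) x y = (x == y)%:R.
Proof. by rewrite /entry mxE (inj_eq enum_rank_inj). Qed.

Lemma entryD A C x y : entry (A + C) x y = entry A x y + entry C x y.
Proof. by rewrite /entry mxE. Qed.

Lemma entryB A C x y : entry (A - C) x y = entry A x y - entry C x y.
Proof. by rewrite /entry !mxE. Qed.

Lemma entryZ (k : R[i]) A x y : entry (k *: A) x y = k * entry A x y.
Proof. by rewrite /entry mxE. Qed.

Lemma entry_sum (I : finType) (F : I -> operator R B) x y :
  entry (\sum_i F i) x y = \sum_i entry (F i) x y.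
Proof. by rewrite /entry summxE. Qed.

Lemma entry_conjtr A x y : entry (A ^t*) x y = (entry A y x)^*%R.
Proof. by rewrite /entry !mxE. Qed.

Lemma trace_entry A : \tr A = \sum_x entry A x x.
Proof. by rewrite /mxtrace sum_enum_rank. Qed.

End Entries.

(** * Positivity and projectors *)

Section Psd.
Variables (R : realType) (n : nat).
Implicit Types (A P Q : 'M[R[i]]_n).

Lemma psdD P Q : psd P -> psd Q -> psd (P + Q).
Proof. by move=> pP pQ v; rewrite mulmxDr mulmxDl mxE addr_ge0 ?pP ?pQ. Qed.

Lemma psdZ (k : R[i]) P : 0 <= k -> psd P -> psd (k *: P).
Proof.
by move=> k0 pP v; rewrite -scalemxAr -scalemxAl mxE mulr_ge0 ?pP.
Qed.

Lemma psd_sum (I : finType) (F : I -> 'M[R[i]]_n) :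
  (forall i, psd (F i)) -> psd (\sum_i F i).
Proof.
move=> pF; elim/big_ind: _ => [v|P Q|i _]; [|exact: psdD|exact: pF].
by rewrite mulmx0 mul0mx mxE.
Qed.

Definition projector A := A ^t* = A /\ A *m A = A.

Lemma psd_projector A : projector A -> psd A.
Proof.
case=> hA iA v; rewrite -{1}iA mulmxA -{1}hA -map_mxM -trmx_mul -mulmxA mxE.
by apply: sumr_ge0 => j _; rewrite !mxE mulrC mul_conjC_ge0.
Qed.

(** By cyclicity this is the trace of [A Q A], whose diagonal entries are values of the form [Q] at
    the columns of [A]. *)
Lemma trace_psd_projector_ge0 Q A : psd Q -> projector A -> 0 <= \tr (Q *m A).
Proof.
move=> pQ [hA iA]; rewrite -iA mulmxA mxtrace_mulC mulmxA.
apply: sumr_ge0 => j _.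
suff -> : (A *m Q *m A) j j = ((col j A) ^t* *m Q *m col j A) 0 0 by exact: pQ.
rewrite -{1}hA tr_col map_row -!row_mul !mxE.
by apply: eq_bigr => k _; rewrite !mxE.
Qed.

End Psd.

(** * Tensor products *)

Section Tensor.
Variables (R : realType) (N : nat) (B : finType).
Implicit Types (X Y : 'I_N -> operator R B) (x y : {ffun 'I_N -> B}).

Lemma entry_tensor X x y :
  entry (tensor X) x y = \prod_i entry (X i) (x i) (y i).
Proof. exact: entry_op_of. Qed.

Lemma eq_tensor X Y : X =1 Y -> tensor X = tensor Y.
Proof.
move=> E; apply: entryP => x y; rewrite !entry_tensor.
by apply: eq_bigr => i _; rewrite E.
Qed.

Lemma tensor_mulmx X Y : tensor X *m tensor Y = tensor (fun i => X i *m Y i).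
Proof.
apply: entryP => x y; rewrite entry_mulmx entry_tensor.
under [RHS]eq_bigr do rewrite entry_mulmx.
rewrite bigA_distr_bigA; apply: eq_bigr => z _.
by rewrite !entry_tensor -big_split.
Qed.

Lemma tensor_conjtr X : (tensor X) ^t* = tensor (fun i => (X i) ^t*).
Proof.
apply: entryP => x y; rewrite entry_conjtr !entry_tensor rmorph_prod.
by apply: eq_bigr => i _; rewrite entry_conjtr.
Qed.

Lemma trace_tensor X : \tr (tensor X) = \prod_i \tr (X i).
Proof.
rewrite trace_entry; under [RHS]eq_bigr do rewrite trace_entry.
by rewrite bigA_distr_bigA; apply: eq_bigr => x _; rewrite entry_tensor.
Qed.

Lemma projector_tensor X : (forall i, projector (X i)) -> projector (tensor X).
Proof.
move=> pX; split.
  by rewrite tensor_conjtr; apply: eq_tensor => i; case: (pX i).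
by rewrite tensor_mulmx; apply: eq_tensor => i; case: (pX i).
Qed.

End Tensor.

(** * Partial transposition *)

Section PartialTranspose.
Variables (R : realType) (N d : nat).

Definition mix_pair (s1 s2 : bool) (x y : pair_basis d) : pair_basis d :=
  (if s1 then y.1 else x.1, if s2 then y.2 else x.2).

Lemma mix_pairK s1 s2 x y :
  mix_pair s1 s2 (mix_pair s1 s2 x y) (mix_pair s1 s2 y x) = x.
Proof. by case: x y s1 s2 => [a b] [a' b'] [] []. Qed.

Definition ptranspose1 (s1 s2 : bool) (A : operator R (pair_basis d)) :
    operator R (pair_basis d) :=
  op_of (fun x y => entry A (mix_pair s1 s2 x y) (mix_pair s1 s2 y x)).

Lemma entry_ptranspose1 s1 s2 A x y :
  entry (ptranspose1 s1 s2 A) x y =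
  entry A (mix_pair s1 s2 x y) (mix_pair s1 s2 y x).
Proof. exact: entry_op_of. Qed.

Variables (G : network N) (S : {set vertex G}).

Lemma mix_mix (x y : net_basis N d) : mix S (mix S x y) (mix S y x) = x.
Proof. by apply/ffunP=> i; rewrite !ffunE; exact: mix_pairK. Qed.

Lemma entry_ptranspose (A : operator R (net_basis N d)) x y :
  entry (ptranspose S A) x y = entry A (mix S x y) (mix S y x).
Proof. exact: entry_op_of. Qed.

Lemma ptranspose_tensor (X : 'I_N -> operator R (pair_basis d)) :
  ptranspose S (tensor X) =
  tensor (fun i => ptranspose1 (end1 G i \in S) (end2 G i \in S) (X i)).
Proof.
apply: entryP => x y; rewrite entry_ptranspose !entry_tensor.
by apply: eq_bigr => i _; rewrite entry_ptranspose1 !ffunE.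
Qed.

Lemma ptransposeZ k (A : operator R (net_basis N d)) :
  ptranspose S (k *: A) = k *: ptranspose S A.
Proof. by apply: entryP => x y; rewrite entryZ !entry_ptranspose entryZ. Qed.

Lemma ptranspose_sum (I : finType) (F : I -> operator R (net_basis N d)) :
  ptranspose S (\sum_i F i) = \sum_i ptranspose S (F i).
Proof.
apply: entryP => x y; rewrite entry_sum entry_ptranspose entry_sum.
by apply: eq_bigr => i _; rewrite entry_ptranspose.
Qed.

(** Partial transposition permutes pairs of indices by an involution, hence is self-adjoint for the
    trace pairing. *)
Lemma trace_ptranspose_mul (A C : operator R (net_basis N d)) :
  \tr (ptranspose S A *m C) = \tr (A *m ptranspose S C).
Proof.
rewrite !trace_entry.
under eq_bigr do rewrite entry_mulmx.
under [RHS]eq_bigr do rewrite entry_mulmx.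
rewrite !pair_big /=.
pose h (p : net_basis N d * net_basis N d) := (mix S p.1 p.2, mix S p.2 p.1).
have hK : involutive h by case=> x y; rewrite /h /= !mix_mix.
rewrite (reindex h) /=; last by apply: onW_bij; exact: inv_bij.
by apply: eq_bigr => -[x y] _; rewrite !entry_ptranspose /= !mix_mix.
Qed.

End PartialTranspose.

(** * Expectations onto spans of product projectors *)

Section Expectation.
Variables (R : realType) (N : nat) (B : finType).
Implicit Types (X Y : 'I_N -> bool -> operator R B) (c : 'I_N -> bool -> R[i]).
Implicit Types (A : operator R {ffun 'I_N -> B}).

Definition tensor_sel X (T : {set 'I_N}) := tensor (fun i => X i (i \in T)).

(* For projectors [X i b] and [c i b] the inverse of their traces, taking
   [Y = X] gives the conditional expectation onto the span of their tensor
   products. *)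
Definition expectation c X Y A : operator R {ffun 'I_N -> B} :=
  \sum_(T : {set 'I_N})
    ((\prod_i c i (i \in T)) * \tr (A *m tensor_sel X T)) *: tensor_sel Y T.

Lemma expectationD c X Y A A' :
  expectation c X Y (A + A') = expectation c X Y A + expectation c X Y A'.
Proof.
rewrite /expectation -big_split /=; apply: eq_bigr => T _.
by rewrite mulmxDl mxtraceD mulrDr scalerDl.
Qed.

Lemma psd_expectation c X A :
  (forall i b, 0 <= c i b) -> (forall i b, projector (X i b)) ->
  psd A -> psd (expectation c X X A).
Proof.
move=> c0 pX pA; apply: psd_sum => T.
have pT : projector (tensor_sel X T) by exact: projector_tensor.
apply: psdZ (psd_projector pT); rewrite mulr_ge0 ?trace_psd_projector_ge0 //.
exact: prodr_ge0.
Qed.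

(** A set [T] is one independent boolean per label, so the kernel of the map is a product of
    single-edge kernels. Expectations can thus be compared edge by edge. *)
Lemma entry_expectation c X Y A x y :
  entry (expectation c X Y A) x y =
  \sum_u \sum_v entry A u v *
    \prod_i \sum_b c i b * entry (X i b) (v i) (u i) * entry (Y i b) (x i) (y i).
Proof.
rewrite entry_sum.
under [RHS]eq_bigr do under eq_bigr do
  [under eq_bigr do rewrite big_bool; rewrite bigA_distr big_distrr /=].
under [RHS]eq_bigr do rewrite exchange_big.
rewrite exchange_big; apply: eq_bigr => T _ /=.
rewrite entryZ trace_entry big_distrr big_distrl; apply: eq_bigr => u _ /=.
rewrite entry_mulmx big_distrr big_distrl; apply: eq_bigr => v _ /=.
rewrite !entry_tensor mulrCA -!mulrA; congr (_ * _).
rewrite mulrA -!big_split /=; apply: eq_bigr => i _.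
by case: ifP.
Qed.

Lemma eq_expectation c X Y c' X' Y' A :
  (forall i u v x y,
     \sum_b c i b * entry (X i b) u v * entry (Y i b) x y =
     \sum_b c' i b * entry (X' i b) u v * entry (Y' i b) x y) ->
  expectation c X Y A = expectation c' X' Y' A.
Proof.
move=> E; apply: entryP => x y; rewrite !entry_expectation.
apply: eq_bigr => u _; apply: eq_bigr => v _; congr (_ * _).
by apply: eq_bigr => i _; exact: E.
Qed.

(** The products for distinct sets are orthogonal for the trace, because some label lies in only one
    of the sets; [c] normalises the remaining term. *)
Lemma expectation_id c X (w : {set 'I_N} -> R[i]) :
  (forall i b, c i b * \tr (X i b *m X i b) = 1) ->
  (forall i, X i true *m X i false = 0) ->
  (forall i, X i false *m X i true = 0) ->
  expectation c X X (\sum_T w T *: tensor_sel X T) =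
  \sum_T w T *: tensor_sel X T.
Proof.
move=> c1 tf0 ft0; apply: eq_bigr => T _; congr (_ *: _).
rewrite mulmx_suml raddf_sum (bigD1 T) //= [Z in _ * (_ + Z)]big1 ?addr0 => [|U UT].
  rewrite -scalemxAl mxtraceZ tensor_mulmx trace_tensor mulrCA -big_split /=.
  by rewrite big1 ?mulr1 // => i _; exact: c1.
rewrite -scalemxAl mxtraceZ tensor_mulmx trace_tensor.
have /existsP[i iUT] : [exists i, (i \in U) != (i \in T)].
  apply: contraR UT => /existsPn noi; apply/eqP/setP=> i.
  by apply/eqP; rewrite -[_ == _]negbK; exact: noi.
rewrite (bigD1 i) //=.
have -> : X i (i \in U) *m X i (i \in T) = 0.
  by case: (i \in U) (i \in T) iUT => [] [] // _; rewrite ?tf0 ?ft0.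
by rewrite mxtrace0 mul0r mulr0.
Qed.

End Expectation.

(** * Moving partial transposes through expectations *)

Section ExpectationPtranspose.
Variables (R : realType) (N d : nat) (G : network N) (S : {set vertex G}).
Implicit Types (X Y : 'I_N -> bool -> operator R (pair_basis d)).

Definition ptranspose_fam X i b :=
  ptranspose1 (end1 G i \in S) (end2 G i \in S) (X i b).

Lemma expectation_ptranspose c X Y (A : operator R (net_basis N d)) :
  expectation c X Y (ptranspose S A) = expectation c (ptranspose_fam X) Y A.
Proof.
apply: eq_bigr => T _; congr (_ * _ *: _).
by rewrite trace_ptranspose_mul ptranspose_tensor.
Qed.

Lemma ptranspose_expectation c X Y (A : operator R (net_basis N d)) :
  ptranspose S (expectation c X Y A) = expectation c X (ptranspose_fam Y) A.
Proof.
rewrite ptranspose_sum; apply: eq_bigr => T _.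
by rewrite ptransposeZ ptranspose_tensor.
Qed.

End ExpectationPtranspose.

(** * Projectors on a single edge *)

Section Edge.
Variables (R : realType) (d : nat).
Hypothesis d2 : (2 <= d)%N.
Notation C := R[i].
Implicit Types (x y u v : pair_basis d).

Let d0 : (d%:R : C) != 0.
Proof. by rewrite pnatr_eq0; case: (d) d2. Qed.

(** At [d = 1] both [1 - Phi] and the antisymmetric projector vanish, and their traces have no
    inverse. *)
Let dB0 : (d%:R - 1 : C) != 0.
Proof. by rewrite subr_eq0 pnatr_eq1; case: (d) d2 => [|[]]. Qed.

Let dD0 : (d%:R + 1 : C) != 0.
Proof. by rewrite natr1 pnatr_eq0. Qed.

Let dB0_ge0 : 0 <= (d%:R - 1 : C).
Proof. by rewrite subr_ge0 ler1n; case: (d) d2. Qed.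

Definition swap_op : operator R (pair_basis d) :=
  op_of (fun x y => ((x.1 == y.2) && (x.2 == y.1))%:R).

Lemma entry_Phi x y :
  entry (Phi R d) x y = ((x.1 == x.2) && (y.1 == y.2))%:R / d%:R.
Proof.
pose q : C := (sqrtC d%:R)^-1.
have phiE z : phi_plus R d (enum_rank z) ord0 = q * (z.1 == z.2)%:R.
  rewrite mxE summxE; congr (_ * _).
  case: z => a b /=; rewrite (bigD1 a) //= big1 ?addr0 => [|k ka].
    by rewrite mxE eqxx andbT (inj_eq enum_rank_inj) xpair_eqE eqxx eq_sym.
  rewrite mxE (inj_eq enum_rank_inj) xpair_eqE.
  by rewrite [a == k]eq_sym (negbTE ka).
have q2 : q * q = d%:R^-1 by rewrite -invfM -expr2 sqrtCK.
have qr : q^*%R = q.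
  by apply: conj_Creal; rewrite ger0_real // invr_ge0 sqrtC_ge0 ler0n.
rewrite /entry mxE big_ord1 phiE 2!mxE phiE.
by rewrite rmorphM /= qr conjC_nat mulrACA q2 -natrM mulnb mulrC.
Qed.

Definition bell b : operator R (pair_basis d) :=
  if b then Phi R d else 1%:M - Phi R d.

(* The projectors onto the symmetric ([true]) and the antisymmetric ([false])
   subspace of C^d (x) C^d. *)
Definition exch (b : bool) : operator R (pair_basis d) :=
  2%:R^-1 *: (if b then 1%:M + swap_op else 1%:M - swap_op).

(** Inverse traces: [Phi] has trace 1 and [1 - Phi] has trace [d^2 - 1]. *)
Definition bell_coef (b : bool) : C :=
  if b then 1 else ((d%:R - 1) * (d%:R + 1))^-1.

(** Inverse dimensions of the symmetric and antisymmetric subspaces, [d (d + 1) / 2] and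
    [d (d - 1) / 2]. *)
Definition exch_coef (b : bool) : C :=
  2%:R / (d%:R * (if b then d%:R + 1 else d%:R - 1)).

Lemma bell_coef_ge0 b : 0 <= bell_coef b.
Proof.
by case: b; rewrite /bell_coef ?ler01 // invr_ge0 mulr_ge0 // addr_ge0 ?ler0n.
Qed.

Lemma exch_coef_ge0 b : 0 <= exch_coef b.
Proof.
apply: divr_ge0; rewrite ?ler0n // mulr_ge0 ?ler0n //.
by case: b => //; rewrite addr_ge0 ?ler0n.
Qed.

Lemma Phi_idem : Phi R d *m Phi R d = Phi R d.
Proof.
apply: entryP => x y; rewrite entry_mulmx entry_Phi.
under eq_bigr do rewrite !entry_Phi.
rewrite -(pair_big xpredT xpredT (fun a b =>
  ((x.1 == x.2) && (a == b))%:R / d%:R *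
  (((a == b) && (y.1 == y.2))%:R / d%:R : C))) /=.
rewrite (eq_bigr (fun _ => ((x.1 == x.2) && (y.1 == y.2))%:R / d%:R / d%:R)).
  by rewrite sumr_const card_ord -[_ *+ d]mulr_natr divfK.
move=> a _; rewrite (bigD1 a) //= big1 ?addr0 => [|b ba].
  by rewrite eqxx andbT /= !mulrA [_ / d%:R * _]mulrAC -natrM mulnb.
by rewrite [a == b]eq_sym (negbTE ba) andbF mul0r mul0r.
Qed.

Lemma Phi_conjtr : (Phi R d) ^t* = Phi R d.
Proof.
apply: entryP => x y; rewrite entry_conjtr !entry_Phi rmorphM /=.
by rewrite fmorphV /= !conjC_nat andbC.
Qed.

Lemma swap_conjtr : swap_op ^t* = swap_op.
Proof.
apply: entryP => x y; rewrite entry_conjtr !entry_op_of conjC_nat.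
by rewrite andbC ![y.1 == _]eq_sym [y.2 == _]eq_sym andbC.
Qed.

Lemma swap_sqr : swap_op *m swap_op = 1%:M.
Proof.
apply: entryP => x y; rewrite entry_mulmx entry1.
rewrite (bigD1 (x.2, x.1)) //= big1 ?addr0 => [|z zx].
  by rewrite !entry_op_of /= !eqxx mul1r andbC.
rewrite !entry_op_of; case: z zx => a b /=; rewrite xpair_eqE negb_and.
rewrite [x.1 == b]eq_sym [x.2 == a]eq_sym.
by case/orP=> /negbTE ->; rewrite ?andbF mul0r.
Qed.

Lemma conjtr1 n : (1%:M : 'M[C]_n) ^t* = 1%:M.
Proof. by rewrite trmx1 map_mx1. Qed.

Lemma projector_bell b : projector (bell b).
Proof.
case: b; rewrite /bell; first by split; [exact: Phi_conjtr|exact: Phi_idem].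
split; first by rewrite raddfB /= map_mxB conjtr1 Phi_conjtr.
by rewrite mulmxBl mul1mx mulmxBr mulmx1 Phi_idem subrr subr0.
Qed.

Lemma projector_exch b : projector (exch b).
Proof.
have hV : (2%:R^-1 : C)^*%R = 2%:R^-1 by rewrite fmorphV /= conjC_nat.
split.
  rewrite /exch linearZ /= map_mxZ /= hV; congr (_ *: _).
  case: b.
    by rewrite raddfD /= map_mxD conjtr1 swap_conjtr.
  by rewrite raddfB /= map_mxB conjtr1 swap_conjtr.
rewrite /exch -scalemxAl -scalemxAr scalerA.
(* This uses that [swap_op] squares to the identity. *)
have E : (if b then 1%:M + swap_op else 1%:M - swap_op) *m
    (if b then 1%:M + swap_op else 1%:M - swap_op) =
  2%:R *: (if b then 1%:M + swap_op else 1%:M - swap_op).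
  rewrite scaler_nat mulr2n; case: b.
    by rewrite mulmxDl mul1mx mulmxDr mulmx1 swap_sqr [swap_op + _]addrC.
  by rewrite mulmxBl mul1mx mulmxBr mulmx1 swap_sqr -[swap_op - _]opprB opprK.
by rewrite E scalerA -mulrA mulVf ?mulr1 // pnatr_eq0.
Qed.

Lemma trace_Phi : \tr (Phi R d) = 1.
Proof.
rewrite trace_entry; under eq_bigr do rewrite entry_Phi andbb.
rewrite -(pair_big xpredT xpredT (fun a b => (a == b)%:R / d%:R : C)) /=.
rewrite (eq_bigr (fun _ => d%:R^-1)).
  by rewrite sumr_const card_ord -[_ *+ d]mulr_natr mulVf.
move=> a _; rewrite (bigD1 a) //= eqxx mul1r big1 ?addr0 // => b ba.
by rewrite eq_sym (negbTE ba) mul0r.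
Qed.

Lemma bell_coef_trace b : bell_coef b * \tr (bell b *m bell b) = 1.
Proof.
case: (projector_bell b) => _ ->; case: b; rewrite /bell_coef /bell.
  by rewrite trace_Phi mulr1.
rewrite raddfB /= mxtrace1 trace_Phi card_prod !card_ord natrM.
rewrite [X in _ * X](_ : _ = (d%:R - 1) * (d%:R + 1)); last by ring.
by rewrite mulVf // mulf_neq0.
Qed.

Lemma ptranspose1_1 s1 s2 :
  ptranspose1 s1 s2 (1%:M : operator R (pair_basis d)) = 1%:M.
Proof.
apply: entryP => -[x1 x2] [y1 y2]; rewrite entry_ptranspose1 !entry1.
by case: s1 s2 => [] []; rewrite /mix_pair /= !xpair_eqE //
  ?[y1 == x1]eq_sym ?[y2 == x2]eq_sym.
Qed.

(** Transposing both factors is the full transpose, which fixes [Phi], a real symmetric matrix; only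
    the parity of [s1] and [s2] matters. *)
Lemma ptranspose1_Phi s1 s2 :
  ptranspose1 s1 s2 (Phi R d) =
  if s1 (+) s2 then d%:R^-1 *: swap_op else Phi R d.
Proof.
apply: entryP => -[x1 x2] [y1 y2]; rewrite entry_ptranspose1.
rewrite entry_Phi; case: s1 s2 => [] [] /=; rewrite ?entryZ ?entry_op_of ?entry_Phi /=.
- by rewrite andbC.
- by rewrite mulrC [y1 == _]eq_sym andbC.
- by rewrite mulrC [y1 == _]eq_sym.
- by [].
Qed.

Lemma ptranspose1_swap s1 s2 :
  ptranspose1 s1 s2 swap_op = if s1 (+) s2 then d%:R *: Phi R d else swap_op.
Proof.
apply: entryP => -[x1 x2] [y1 y2]; rewrite entry_ptranspose1.
rewrite entry_op_of; case: s1 s2 => [] [] /=;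
  rewrite ?entryZ ?entry_op_of ?entry_Phi /= ?[d%:R * (_ / _)]mulrC ?divfK //.
- by rewrite [y1 == x2]eq_sym [y2 == x1]eq_sym andbC.
- by rewrite [x2 == x1]eq_sym andbC.
- by rewrite [y2 == y1]eq_sym.
Qed.

Lemma ptranspose1D s1 s2 (A A' : operator R (pair_basis d)) :
  ptranspose1 s1 s2 (A + A') = ptranspose1 s1 s2 A + ptranspose1 s1 s2 A'.
Proof. by apply: entryP => x y; rewrite entryD !entry_ptranspose1 entryD. Qed.

Lemma ptranspose1Z s1 s2 k (A : operator R (pair_basis d)) :
  ptranspose1 s1 s2 (k *: A) = k *: ptranspose1 s1 s2 A.
Proof. by apply: entryP => x y; rewrite entryZ !entry_ptranspose1 entryZ. Qed.

Lemma ptranspose1B s1 s2 (A A' : operator R (pair_basis d)) :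
  ptranspose1 s1 s2 (A - A') = ptranspose1 s1 s2 A - ptranspose1 s1 s2 A'.
Proof. by rewrite -scaleN1r ptranspose1D ptranspose1Z scaleN1r. Qed.

(* Partial transposition turns [Phi] into [swap_op / d], so that the
   expectation onto the span of [Phi] and [1 - Phi] becomes the one onto the
   span of the symmetric and antisymmetric projectors. *)
Lemma edge_twirl_ptranspose s1 s2 t1 t2 u v x y : s1 (+) s2 = t1 (+) t2 ->
  let X := if t1 (+) t2 then exch else bell in
  let c := if t1 (+) t2 then exch_coef else bell_coef in
  \sum_b bell_coef b * entry (ptranspose1 s1 s2 (bell b)) u v *
    entry (bell b) x y =
  \sum_b c b * entry (X b) u v * entry (ptranspose1 t1 t2 (X b)) x y.
Proof.
move=> st /=; rewrite !big_bool /=; case: ifP => t12; rewrite t12 in st; last first.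
  by rewrite !ptranspose1B !ptranspose1_1 !ptranspose1_Phi st t12.
rewrite !ptranspose1Z !ptranspose1B ptranspose1D !ptranspose1_1.
rewrite ptranspose1_swap !ptranspose1_Phi st t12.
rewrite /exch /exch_coef !(entryZ, entryB, entryD).
have n2 : (2%:R : C) != 0 by rewrite pnatr_eq0.
(* Both sides are bilinear in entries of [1], [swap_op] at [u v] and of [1], [Phi] at [x y], with
   coefficients rational in [d]. *)
by field; rewrite dB0 d0 dD0.
Qed.

End Edge.

(** * Transfer of decompositions between networks *)

Lemma decomposable_same_cuts (R : realType) (N d : nat) (w : {set 'I_N} -> R)
    (G G' : network N) (S : {set vertex G}) (S' : {set vertex G'})
    (P Q : operator R (net_basis N d)) :
  (2 <= d)%N -> cuts S' =1 cuts S -> psd P -> psd Q ->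
  sub_symmetric d w = P + ptranspose S' Q ->
  exists P1 Q1 : operator R (net_basis N d),
    [/\ psd P1, psd Q1 & sub_symmetric d w = P1 + ptranspose S Q1].
Proof.
move=> d2 eqC pP pQ eW.
pose b (i : 'I_N) := bell R d; pose cb (i : 'I_N) := bell_coef R d.
pose X i := if cuts S i then exch R d else bell R d.
pose c i := if cuts S i then exch_coef R d else bell_coef R d.
exists (expectation cb b b P), (expectation c X X Q); split.
- apply: psd_expectation => // i t; last exact: projector_bell.
  exact: bell_coef_ge0.
- apply: psd_expectation => // i t; rewrite /c /X; case: ifP => _.
  + exact: exch_coef_ge0.
  + exact: bell_coef_ge0.
  + exact: projector_exch.
  + exact: projector_bell.
have eE : expectation cb b b (sub_symmetric d w) = sub_symmetric d w.
  apply: (@expectation_id R N (pair_basis d) cb b (fun T => (w T)%:C)) => i.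
  - exact: bell_coef_trace.
  - by rewrite /b /bell mulmxBr mulmx1 Phi_idem // subrr.
  - by rewrite /b /bell mulmxBl mul1mx Phi_idem // subrr.
(* Both transposes are absorbed into the single-edge families, leaving an identity on each edge. *)
rewrite -{1}eE eW expectationD expectation_ptranspose ptranspose_expectation.
congr (_ + _); apply: eq_expectation => i u v x y.
exact: (edge_twirl_ptranspose R d2 u v x y (eqC i)).
Qed.

Lemma tree_SSW_all (R : realType) (N d : nat) (T G : network N)
    (W : operator R (net_basis N d)) :
  (2 <= d)%N -> is_tree T -> SSW T W -> SSW G W.
Proof.
move=> d2 acyc [[w Ww] [hermW decT]]; split; first by exists w.
split=> // S S0 ST.
have [j Sj] := nontrivial_cuts S0 ST.
have [S' eqC] := tree_cuts_all (cuts S) acyc.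
(* Since [S'] also cuts [j], it is neither empty nor full. *)
have [||P [Q [pP pQ eW]]] := decT S'.
- by apply: contraTneq Sj => S'0; rewrite -eqC S'0 cuts_set0.
- by apply: contraTneq Sj => S'T; rewrite -eqC S'T cuts_setT.
rewrite Ww in eW *; exact: decomposable_same_cuts d2 eqC pP pQ eW.
Qed.

Theorem mainTheorem4 (R : realType) (N d : nat) (hN : (1 <= N)%N)
    (hd : (2 <= d)%N) :
  (forall T : network N, is_tree T ->
     forall (G : network N) (W : operator R (net_basis N d)),
       SSW T W -> SSW G W) /\
  (forall T1 T2 : network N, is_tree T1 -> is_tree T2 ->
     forall W : operator R (net_basis N d), SSW T1 W <-> SSW T2 W).
Proof.
split=> [T treeT G W|T1 T2 tree1 tree2 W]; first exact: tree_SSW_all.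
by split; exact: tree_SSW_all.
Qed.
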